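(* Let $(X,\mathcal{A},\mu)$ be a monotone measure space, $E\in\mathcal{A}$ and $p\ge 1$. If $\mu$ is subadditive and continuous from below, then $\mathcal{L}^{p}_{\mu}(E)$, equipped with the metric $\rho(f,g)=\|f-g\|_{\mu,p}$ (functions that are equal $\mu$-a.e. on $E$ being identified), is a complete metric space.
   Context: $X$ is a nonempty set and $\mathcal{A}$ a $\sigma$-algebra of subsets of $X$. A monotone measure on $(X,\mathcal{A})$ is a set function $\mu:\mathcal{A}\to[0,+\infty]$ with $\mu(\emptyset)=0$, $\mu(X)>0$, and $\mu(A)\le\mu(B)$ whenever $A\subset B$, $A,B\in\mathcal{A}$; then $(X,\mathcal{A},\mu)$ is called a monotone measure space. $\mu$ is subadditive if $\mu(A\cup B)\le\mu(A)+\mu(B)$ for all $A,B\in\mathcal{A}$. $\mu$ is continuous from below if $\mu(\bigcup_{n=1}^{\infty}E_n)=\lim_{n\to\infty}\mu(E_n)$ for every sequence $E_1\subset E_2\subset\cdots$ in $\mathcal{A}$. For a nonnegative real-valued measurable $h$ on $X$, the pan-integral (based on the usual $+$ and $\cdot$) is $$\int^{pan}h\,d\mu=\sup\Big\{\sum_{i=1}^{n}\lambda_i\mu(A_i):\ \sum_{i=1}^{n}\lambda_i\chi_{A_i}\le h,\ \{A_i\}_{i=1}^{n}\subset\mathcal{A}\text{ is a partition of }X,\ \lambda_i\ge 0,\ n\in\mathbb{N}\Big\}\in[0,\infty],$$ where $\chi_A$ is the characteristic function of $A$, a (finite) partition of $X$ is a finite family of pairwise disjoint sets in $\mathcal{A}$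 with union $X$, and $0\cdot\infty=0$. For $E\in\mathcal{A}$ and a nonnegative measurable function $h$ on $E$, $\int_E^{pan}h\,d\mu=\int^{pan}h\cdot\chi_E\,d\mu$, where $h\cdot\chi_E$ is $h$ extended by $0$ outside $E$. For $p\ge1$ and measurable $f:E\to\mathbb{R}$, $\|f\|_{\mu,p}=\left(\int_E^{pan}|f|^{p}\,d\mu\right)^{1/p}$, and $\mathcal{L}^{p}_{\mu}(E)$ is the set of measurable $f:E\to\mathbb{R}$ with $\|f\|_{\mu,p}<\infty$. Two functions $f,g$ are equal $\mu$-a.e. on $E$ if $\mu(\{x\in E: f(x)\ne g(x)\})=0$. *)

(* Defs.v *)
From HB Require Import structures.
From mathcomp Require Import all_boot all_order all_algebra.
From mathcomp Require Import all_classical all_reals all_analysis.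

Set Implicit Arguments.
Unset Strict Implicit.
Unset Printing Implicit Defensive.

Import Order.TTheory GRing.Theory Num.Theory.
Import numFieldNormedType.Exports.

Local Open Scope classical_set_scope.
Local Open Scope ring_scope.

Section MonotoneMeasure.
Context {d : measure_display} {X : measurableType d} {R : realType}.

(* A set function on the sigma-algebra is represented by a function on all sets;
   its values on nonmeasurable sets are never used. *)
Implicit Type mu : set X -> \bar R.

Record monotone_measure mu : Prop := MonotoneMeasure {
  monotone_measure0 : mu set0 = 0%E ;
  monotone_measure_ge0 : forall A, measurable A -> (0 <= mu A)%E ;
  monotone_measureT : (0 < mu setT)%E ;
  monotone_measure_le : forall A B, measurable A -> measurable B ->
    A `<=` B -> (mu A <= mu B)%E
}.

Definition subadditive_measure mu : Prop :=
  forall A B, measurable A -> measurable B -> (mu (A `|` B) <= mu A + mu B)%E.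

Definition continuous_from_below mu : Prop :=
  forall F : (set X)^nat, (forall n, measurable (F n)) ->
    (forall n, F n `<=` F n.+1) ->
    mu (F n) @[n --> \oo] --> mu (\bigcup_n F n).

(* The blocks of a partition may be empty. *)
Definition finite_partition n (A : 'I_n -> set X) : Prop :=
  [/\ forall i, measurable (A i), trivIset setT A & cover setT A = setT].

Definition pan_integral mu (h : X -> R) : \bar R :=
  ereal_sup [set s | exists (n : nat) (lambda : 'I_n -> R) (A : 'I_n -> set X),
    [/\ finite_partition A,
        forall i, 0 <= lambda i,
        forall x, \sum_(i < n) lambda i * \1_(A i) x <= h x &
        s = (\sum_(i < n) (lambda i)%:E * mu (A i))%E] ].

Definition pan_integral_on mu (E : set X) (h : X -> R) : \bar R :=
  pan_integral mu (fun x => h x * \1_E x).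

Definition pan_norm mu (E : set X) (p : R) (f : X -> R) : \bar R :=
  (pan_integral_on mu E (fun x => `|f x| `^ p)%R `^ p^-1)%E.

(* A function E -> R is represented by its extensions to X: measurability, the
   norm and almost everywhere equality below only involve the values on E, and
   two extensions of the same function are equal almost everywhere on E. *)
Definition pan_Lp mu (E : set X) (p : R) : set (X -> R) :=
  [set f | measurable_fun E f /\ (pan_norm mu E p f < +oo)%E].

Definition ae_equal_on mu (E : set X) (f g : X -> R) : Prop :=
  mu (E `&` [set x | f x <> g x]) = 0%E.

End MonotoneMeasure.

Definition complete_metric {R : realType} (M : metricType R) : Prop :=
  forall u : nat -> M, cauchy (u n @[n --> \oo]) ->
    exists l : M, u n @[n --> \oo] --> l.

(* Main.v *)
Require Import Defs.
From HB Require Import structures.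
From mathcomp Require Import all_boot all_order all_algebra.
From mathcomp Require Import all_classical all_reals all_analysis.
From mathcomp Require Import generic_quotient measurable_realfun ring.

Set Implicit Arguments.
Unset Strict Implicit.
Unset Printing Implicit Defensive.

Import Order.TTheory GRing.Theory Num.Theory.
Import numFieldNormedType.Exports.

Local Open Scope classical_set_scope.
Local Open Scope ring_scope.

(** Subadditivity makes the sum [sum_i lambda_i * mu (A_i)] grow when the blocks
    are refined, so the pan-integral is governed by the total variation
    [nu A := sup (sum_i mu (A_i))] over the finite families of disjoint
    measurable subsets of [A], which is the pan-integral of the indicator of
    [A].  The set function [nu] is a measure.  Juxtaposing families gives
    [nu A + nu B <= nu (A `|` B)] for disjoint sets
    ([pan_integral_superadditive]).  Conversely, [mu] is countably subadditive
    because it is subadditive and continuous from below; cutting the blocks of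
    a family along a countable cover and exchanging the two sums transfers this
    to [nu] ([pan_indic_sigma_subadditive]).

    The pan-integral with respect to [mu] is then the Lebesgue integral with
    respect to [nu] ([pan_integralE]), and [mu] and [nu] have the same null sets
    ([pan_indic_eq0]).  Hence [pan_norm mu E p f] is the usual p-norm, with
    respect to [nu], of [f] extended by zero outside [E], and the theorem
    becomes the Riesz-Fischer theorem for [nu] ([Lnorm_complete]): a Cauchy
    sequence has a subsequence whose increments have geometrically decreasing
    norms, monotone convergence shows that this subsequence converges almost
    everywhere, and Fatou's lemma shows that the whole sequence converges in
    norm to the limit.  The metric space is the quotient of the set of
    p-integrable functions by the relation of being at distance zero
    ([metric_quotient_exists]). *)

(** * The pan-integral through disjoint families *)

Section PanIntegral.
Context {d : measure_display} {X : measurableType d} {R : realType}.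
Context (mu : set X -> \bar R) (mu_mono : monotone_measure mu).
Implicit Types (h : X -> R) (A B : set X).

(** Blocks are indexed by an arbitrary finite type and may leave a part of [X]
    uncovered, so that minorants can be cut, restricted and juxtaposed without
    renumbering or completing them. *)
Definition simple_minorant (I : finType) (lambda : I -> R) (A : I -> set X) h :=
  [/\ forall i, measurable (A i), trivIset setT A, forall i, 0 <= lambda i &
      forall x, \sum_i lambda i * \1_(A i) x <= h x].

Lemma measure_term_ge0 (r : R) A :
  0 <= r -> measurable A -> (0 <= r%:E * mu A)%E.
Proof. by move=> r0 mA; rewrite mule_ge0// monotone_measure_ge0. Qed.

(** The complement of the blocks, taken with coefficient zero, completes the
    family into a partition. *)
Lemma minorant_sum_le_pan (I : finType) (lambda : I -> R) (A : I -> set X) h :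
  simple_minorant lambda A h ->
  (\sum_i (lambda i)%:E * mu (A i) <= pan_integral mu h)%E.
Proof.
move=> [mA tA l0 lh]; apply: ereal_sup_ubound.
pose ev i := @enum_val I predT i.
pose lambda' (i : 'I_#|I|.+1) := oapp (lambda \o ev) 0 (unlift ord0 i).
pose A' (i : 'I_#|I|.+1) :=
  oapp (A \o ev) (~` \bigcup_i A i) (unlift ord0 i).
exists #|I|.+1, lambda', A'; split.
- split.
  + move=> i; rewrite /A'; case: unliftP => [j _|_] /=; first exact: mA.
    apply: measurableC; apply: fin_bigcup_measurable => [|i' _].
      exact: finite_finset.
    exact: mA.
  + move=> i j _ _; rewrite /A'.
    case: unliftP => [i'|] ->; case: unliftP => [j'|] -> //=.
    * by move=> /(tA _ _ Logic.I Logic.I)/enum_val_inj ->.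
    * by move=> [x [xi nx]]; exfalso; apply: nx; exists (ev i').
    * by move=> [x [nx xj]]; exfalso; apply: nx; exists (ev j').
  + apply/seteqP; split => // x _.
    have [[i _ xi]|nx] := pselect ((\bigcup_i A i) x).
      exists (lift ord0 (enum_rank i)) => //.
      by rewrite /A' liftK /= /ev enum_rankK.
    by exists ord0 => //; rewrite /A' unlift_none.
- by move=> i; rewrite /lambda'; case: unliftP => [j _|_] /=.
- move=> x; rewrite big_ord_recl /lambda' /A' unlift_none /= mul0r add0r.
  under eq_bigr do rewrite liftK /=.
  rewrite -(reindex ev (P := predT) (F := fun i => lambda i * \1_(A i) x))//=.
  exact: onW_bij (enum_val_bij I).
- rewrite big_ord_recl /lambda' /A' unlift_none /= mul0e add0e.
  under [RHS]eq_bigr do rewrite liftK /=.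
  rewrite (reindex ev)//=.
  exact: onW_bij (enum_val_bij I).
Qed.

Lemma pan_integral_le h (c : \bar R) :
  (forall (I : finType) (lambda : I -> R) (A : I -> set X),
    simple_minorant lambda A h -> (\sum_i (lambda i)%:E * mu (A i) <= c)%E) ->
  (pan_integral mu h <= c)%E.
Proof.
move=> hc; apply: ge_ereal_sup => _ [n [lambda [A [[mA tA _] l0 lh ->]]]].
exact: hc.
Qed.

Lemma pan_integral_ge0 h : (forall x, 0 <= h x) -> (0 <= pan_integral mu h)%E.
Proof.
move=> h0; have : simple_minorant (fun i : 'I_0 => 0) (fun=> set0) h.
  by split => //[[]//|x]; rewrite big_ord0.
by move/minorant_sum_le_pan; rewrite big_ord0.
Qed.

Lemma le_pan_integral h h' : (forall x, h x <= h' x) ->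
  (pan_integral mu h <= pan_integral mu h')%E.
Proof.
move=> hh'; apply: pan_integral_le => I lambda A [mA tA l0 lh].
by apply: minorant_sum_le_pan; split => // x; apply: le_trans (hh' x).
Qed.

Lemma minorant_coef_le (I : finType) (lambda : I -> R) (A : I -> set X) h i x :
  simple_minorant lambda A h -> A i x -> lambda i <= h x.
Proof.
move=> [_ _ l0 lh] xi; apply: le_trans (lh x).
rewrite (bigD1 i)//= indicE mem_set// mulr1 lerDl sumr_ge0// => j _.
by rewrite mulr_ge0.
Qed.

(** Emptying the blocks of coefficient zero leaves the sum unchanged and puts
    the remaining blocks inside the support of the function. *)
Lemma minorant_supported (I : finType) (lambda : I -> R) (A : I -> set X) h :
  simple_minorant lambda A h -> exists B : I -> set X,
    [/\ simple_minorant lambda B h,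
        forall i x, B i x -> 0 < h x &
        (\sum_i (lambda i)%:E * mu (A i) =
         \sum_i (lambda i)%:E * mu (B i))%E].
Proof.
move=> lA; have [mA tA l0 lh] := lA.
pose B i := if lambda i == 0 then set0 else A i.
have BA i x : B i x -> A i x by rewrite /B; case: ifP.
exists B; split.
- split => //.
  + by move=> i; rewrite /B; case: ifP.
  + by move=> i j _ _ [x [/BA xi /BA xj]]; apply: tA => //; exists x.
  + move=> x; apply: le_trans (lh x); apply: ler_sum => i _.
    rewrite /B; case: eqP => [->|//]; by rewrite !mul0r.
- move=> i x; rewrite /B; case: eqP => // /eqP li0 xi.
  by apply: lt_le_trans (minorant_coef_le lA xi); rewrite lt0r li0 l0.
- apply: eq_bigr => i _; rewrite /B; case: eqP => [->|//]; by rewrite !mul0e.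
Qed.

Lemma pan_integralZ (r : R) h : 0 <= r -> (forall x, 0 <= h x) ->
  (r%:E * pan_integral mu h <= pan_integral mu (fun x => r * h x)%R)%E.
Proof.
rewrite le_eqVlt => /predU1P[<- h0|r0 h0].
  by rewrite mul0e pan_integral_ge0// => x; rewrite mul0r.
rewrite -lee_pdivlMl//; apply: pan_integral_le => I lambda A [mA tA l0 lh].
rewrite lee_pdivlMl// ge0_sume_distrr; last first.
  by move=> i _; exact: measure_term_ge0.
under eq_bigr do rewrite muleA -EFinM.
apply: minorant_sum_le_pan; split => //.
  by move=> i; rewrite mulr_ge0// ltW.
move=> x; under eq_bigr do rewrite -mulrA.
by rewrite -mulr_sumr ler_pM2l.
Qed.

(** Minorants of functions with disjoint supports can be juxtaposed. *)
Lemma pan_integral_superadditive h h' :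
  (forall x, 0 <= h x) -> (forall x, 0 <= h' x) ->
  (forall x, h x = 0 \/ h' x = 0) ->
  (pan_integral mu h + pan_integral mu h' <=
   pan_integral mu (fun x => h x + h' x)%R)%E.
Proof.
move=> h0 h'0 hh'.
have [->|] := eqVneq (pan_integral mu (fun x => h x + h' x)) +oo%E.
  by rewrite leey.
set c := pan_integral _ _; rewrite -ltey => c_lty.
have c_fin : c \is a fin_num.
  by rewrite ge0_fin_numE// pan_integral_ge0// => x; rewrite addr_ge0.
suff sum_le (I J : finType) (lambda : I -> R) (kappa : J -> R)
    (A : I -> set X) (B : J -> set X) :
    simple_minorant lambda A h -> simple_minorant kappa B h' ->
    (\sum_i (lambda i)%:E * mu (A i) + \sum_j (kappa j)%:E * mu (B j) <= c)%E.
  have hle : (pan_integral mu h <= c)%E.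
    by apply: le_pan_integral => x; rewrite lerDl.
  have h_fin : pan_integral mu h \is a fin_num.
    by rewrite ge0_fin_numE ?(le_lt_trans hle)// pan_integral_ge0.
  rewrite -leeBrDl//; apply: pan_integral_le => J kappa B kB.
  rewrite leeBrDl//.
  have s_fin : (\sum_j (kappa j)%:E * mu (B j))%E \is a fin_num.
    rewrite ge0_fin_numE.
      apply: le_lt_trans (minorant_sum_le_pan kB) _.
      by apply: le_lt_trans c_lty; apply: le_pan_integral => x; rewrite lerDr.
    by have [mB _ k0 _] := kB; apply: sume_ge0 => j _; exact: measure_term_ge0.
  rewrite -leeBrDr//; apply: pan_integral_le => I lambda A lA.
  by rewrite leeBrDr//; exact: sum_le.
move=> /minorant_supported[A' [[mA tA l0 lh] Ah ->]].
move=> /minorant_supported[B' [[mB tB k0 kh'] Bh ->]].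
pose nu (k : I + J) := match k with inl i => lambda i | inr j => kappa j end.
pose C (k : I + J) := match k with inl i => A' i | inr j => B' j end.
have : simple_minorant nu C (fun x => h x + h' x).
  split.
  - by case.
  - have disj i j : ~ ((A' i `&` B' j) !=set0).
      move=> [x [/Ah hx /Bh h'x]].
      by case: (hh' x) hx h'x => ->; rewrite ltxx.
    move=> [i|i] [j|j] _ _ /=.
    + by move/(tA _ _ Logic.I Logic.I) => ->.
    + by move/disj.
    + by rewrite setIC => /disj.
    + by move/(tB _ _ Logic.I Logic.I) => ->.
  - by case.
  - by move=> x; rewrite big_sumType /= lerD.
by move/minorant_sum_le_pan; rewrite big_sumType.
Qed.

End PanIntegral.

(** * The measure generated by a subadditive monotone measure *)

Section GeneratedMeasure.
Import HBNNSimple.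
Context {d : measure_display} {X : measurableType d} {R : realType}.
Context (mu : set X -> \bar R) (mu_mono : monotone_measure mu).
Context (mu_sub : subadditive_measure mu) (mu_cfb : continuous_from_below mu).
Implicit Types (A B : set X) (F : (set X)^nat).

(** Finite subadditivity bounds [mu] on the finite unions of the pieces
    [B `&` F i]; continuity from below passes to the limit. *)
Lemma measure_sigma_subadditive_cover B F :
  measurable B -> (forall n, measurable (F n)) -> B `<=` \bigcup_n F n ->
  (mu B <= \sum_(n <oo) mu (B `&` F n))%E.
Proof.
move=> mB mF BF.
have mBF n : measurable (B `&` F n) by exact: measurableI.
pose G n := \big[setU/set0]_(i < n) (B `&` F i).
have mG n : measurable (G n) by exact: bigsetU_measurable.
have G_sum n : (mu (G n) <= \sum_(0 <= i < n) mu (B `&` F i))%E.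
  elim: n => [|n IH].
    by rewrite /G big_ord0 big_geq// monotone_measure0.
  rewrite big_nat_recr//= /G big_ord_recr /=.
  by apply: le_trans (mu_sub (mG n) (mBF n)) _; exact: leeD2r.
have GB : \bigcup_n G n = B.
  rewrite -[RHS](setIidl BF) setI_bigcupr -[RHS]bigcup_bigsetU_bigcup.
  apply/seteqP; split => x [n _ xn]; last by exists n.+1.
  case: n xn => [|n] xn; first by rewrite /G big_ord0 in xn.
  by exists n.
have cvgG : mu (G n) @[n --> \oo] --> mu B.
  rewrite -GB; apply: mu_cfb => // n; rewrite /G big_ord_recr /=.
  exact: subsetUl.
rewrite -(cvg_lim _ cvgG)//; apply: lime_le.
  by apply/cvg_ex; exists (mu B).
apply: nearW => n; apply: le_trans (G_sum n) _.
by apply: nneseries_lim_ge => i _ _; rewrite monotone_measure_ge0.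
Qed.

Lemma pan_indic_ge A : measurable A -> (mu A <= pan_integral mu \1_A)%E.
Proof.
move=> mA; have : simple_minorant (fun i : 'I_1 => 1) (fun=> A) (\1_A : X -> R).
  split => // [i j _ _ _|x]; first by rewrite !ord1.
  by rewrite big_ord1 mul1r.
by move=> /minorant_sum_le_pan => /(_ mu); rewrite big_ord1 mul1e.
Qed.

Lemma indic_gt0 A x : 0 < (\1_A x : R) -> A x.
Proof.
by rewrite indicE; case: (boolP (x \in A)) => [/set_mem|_]//; rewrite ltxx.
Qed.

Lemma pan_indic_eq0 A : measurable A ->
  pan_integral mu \1_A = 0%E <-> mu A = 0%E.
Proof.
move=> mA; split=> [A0|A0]; apply/eqP; rewrite eq_le.
  by rewrite -{1}A0 pan_indic_ge//= monotone_measure_ge0.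
rewrite pan_integral_ge0 ?andbT//; apply: pan_integral_le => I lambda B.
move=> /(minorant_supported mu)[C [[mC _ l0 _] CA ->]].
rewrite big1// => i _; suff -> : mu (C i) = 0%E by rewrite mule0.
apply/eqP; rewrite eq_le monotone_measure_ge0// andbT -A0.
by apply: monotone_measure_le => // x /CA/indic_gt0.
Qed.

(** A block contained in the union of the [F n] is cut by them into countably
    many pieces; for fixed [n] the pieces are the blocks of a minorant of the
    indicator of [F n]. *)
Lemma pan_indic_sigma_subadditive A F :
  measurable A -> (forall n, measurable (F n)) -> A `<=` \bigcup_n F n ->
  (pan_integral mu \1_A <= \sum_(n <oo) pan_integral mu \1_(F n))%E.
Proof.
move=> mA mF AF; apply: pan_integral_le => I lambda C.
move=> /(minorant_supported mu)[B [[mB tB l0 lA] BA ->]].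
have mBF i n : measurable (B i `&` F n) by exact: measurableI.
have t0 i n : (0 <= (lambda i)%:E * mu (B i `&` F n))%E.
  exact: measure_term_ge0.
apply: (@le_trans _ _
    (\sum_i \sum_(n <oo) (lambda i)%:E * mu (B i `&` F n))%E).
  apply: lee_sum => i _; rewrite nneseriesZl; last first.
    by move=> n _; rewrite monotone_measure_ge0.
  apply: lee_wpmul2l; first by rewrite lee_fin.
  by apply: measure_sigma_subadditive_cover => // x /BA/indic_gt0/AF.
rewrite -nneseries_sum//; apply: lee_nneseries => [n _ _|n _].
  by apply: sume_ge0.
apply: minorant_sum_le_pan; split => //.
  by move=> i j _ _ [x [[xi _] [xj _]]]; apply: tB => //; exists x.
move=> x; under eq_bigr do rewrite indicI mulrA.
rewrite -mulr_suml -[leRHS]mul1r ler_wpM2r//; apply: le_trans (lA x) _.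
by rewrite indicE; case: (_ \in _).
Qed.

Lemma pan_indic_additive : additive2 (fun A => pan_integral mu \1_A).
Proof.
move=> A B mA mB AB0; apply/eqP; rewrite eq_le; apply/andP; split; last first.
  have AB x : x \in A -> x \notin B.
    move=> /set_mem xA; apply/negP => /set_mem xB.
    by have : set0 x by rewrite -AB0.
  rewrite (_ : \1_(A `|` B) = fun x => \1_A x + \1_B x :> R).
    apply: pan_integral_superadditive => // x; rewrite !indicE.
    by case: (boolP (x \in A)) => [/AB/negbTE ->|_]; [right|left].
  apply/funext => x; rewrite !indicE in_setU.
  by case: (boolP (x \in A)) => [/AB/negbTE ->|_]; rewrite ?addr0 ?add0r.
have A0 C : (0 <= pan_integral mu (\1_C : X -> R))%E by exact: pan_integral_ge0.
apply: le_trans (pan_indic_sigma_subadditive (F := bigcup2 A B) _ _ _) _.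
- exact: measurableU.
- by move=> [|[|n]] /=.
- by rewrite bigcup2E.
rewrite (nneseries_split 0 2)//= big_mkord !big_ord_recl big_ord0/= adde0.
rewrite eseries0 ?adde0// => -[|[|n]]//= _ _.
by rewrite (proj2 (pan_indic_eq0 measurable0))// monotone_measure0.
Qed.

(** The value at [A] is the total variation of [mu] over finite partitions of
    [A], which the subadditivity of [mu] makes additive and its continuity from
    below makes countably additive. *)
Lemma generated_measure_exists :
  exists nu : {measure set X -> \bar R}, forall A, nu A = pan_integral mu \1_A.
Proof.
pose nu0 (A : set X) := pan_integral mu (\1_A : X -> R).
have nu0_ge0 A : (0 <= nu0 A)%E by exact: pan_integral_ge0.
have nu00 : nu0 set0 = 0%E.
  by apply/(pan_indic_eq0 measurable0); rewrite monotone_measure0.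
have nu0_add : measure_function.semi_additive nu0.
  by apply/(additive2P nu00); exact: pan_indic_additive.
pose nu1 : {content set X -> \bar R} :=
  HB.pack nu0 (isContent.Build d X R nu0 nu0_ge0 nu0_add).
have nu1_sub : measurable_subset_sigma_subadditive nu1.
  by move=> A F mF mA; exact: pan_indic_sigma_subadditive.
pose nu2 : {measure set X -> \bar R} :=
  HB.pack nu0 nu1 (Content_SigmaSubAdditive_isMeasure.Build d R X nu1 nu1_sub).
by exists nu2.
Qed.

(** A minorant has a smaller sum than integral because [mu <= nu] on its blocks.
    In the other direction, a simple function below [h] is the sum of its
    restrictions to its level sets: these have disjoint supports, and the
    pan-integral of [y * \1_A] is at least [y * nu A]. *)
Lemma pan_integralE (nu : {measure set X -> \bar R}) (h : X -> R) :
  (forall A, nu A = pan_integral mu \1_A) ->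
  measurable_fun setT h -> (forall x, 0 <= h x) ->
  pan_integral mu h = (\int[nu]_x (h x)%:E)%E.
Proof.
move=> nuE mh h0; apply/eqP; rewrite eq_le; apply/andP; split.
  apply: pan_integral_le => I lambda A [mA _ l0 lh].
  have term0 i x : (0 <= (lambda i * \1_(A i) x)%:E :> \bar R)%E.
    by rewrite lee_fin mulr_ge0.
  have mterm i : measurable_fun setT (fun x => (lambda i * \1_(A i) x)%:E).
    by apply/measurable_EFinP/measurable_funM.
  apply: (@le_trans _ _ (\sum_i \int[nu]_x (lambda i * \1_(A i) x)%:E)%E).
    apply: lee_sum => i _.
    under eq_integral do rewrite EFinM.
    rewrite ge0_integralZl_EFin//; last first.
      by apply/measurable_EFinP/measurable_indic.
    rewrite integral_indic// setIT nuE lee_wpmul2l ?lee_fin//.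
    exact: pan_indic_ge.
  rewrite -ge0_integral_sum//; apply: ge0_le_integral => //.
  - by move=> x _; apply: sume_ge0.
  - exact: emeasurable_sum.
  - exact/measurable_EFinP.
  - by move=> x _; rewrite sumEFin lee_fin.
rewrite ge0_integralTE; last by move=> x; rewrite lee_fin.
apply: ge_ereal_sup => _ [g /= gh <-].
have g_term y x : 0 <= y -> 0 <= y * \1_(g @^-1` [set y]) x :> R.
  by move=> y0; rewrite mulr_ge0.
pose G (s : seq R) x := \sum_(y <- s) y * \1_(g @^-1` [set y]) x.
have sum_le (s : seq R) : uniq s -> {in s, forall y, 0 <= y} ->
    (\sum_(y <- s) y%:E * nu (g @^-1` [set y]) <=
     pan_integral mu (G s))%E.
  elim: s => [_ _|y s IH /= /andP[ys us] s0].
    by rewrite big_nil pan_integral_ge0// => x; rewrite /G big_nil.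
  have y0 : 0 <= y by apply: s0; rewrite mem_head.
  have {}s0 z : z \in s -> 0 <= z by move=> zs; apply: s0; rewrite inE zs orbT.
  rewrite big_cons.
  have -> : G (y :: s) = fun x => y * \1_(g @^-1` [set y]) x + G s x.
    by apply/funext => x; rewrite /G big_cons.
  apply: le_trans (pan_integral_superadditive mu_mono _ _ _).
  - apply: leeD; last exact: IH.
    by rewrite nuE; exact: pan_integralZ.
  - by move=> x; exact: g_term.
  - by move=> x; rewrite /G big_seq sumr_ge0// => z /s0; exact: g_term.
  - move=> x; have [gxy|gxy] := eqVneq (g x) y; last first.
      by left; rewrite indicE memNset ?mulr0// => /eqP; rewrite (negbTE gxy).
    right; rewrite /G big_seq big1// => z zs.
    rewrite indicE memNset ?mulr0//= => gxz.
    by move: ys; rewrite -gxy gxz zs.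
rewrite sintegralE fsbig_finite//=.
apply: le_trans (sum_le _ (finmap.fset_uniq _) _) _.
  by move=> y; rewrite in_fset_set// => /set_mem[x _ <-].
apply: le_pan_integral => // x.
rewrite /G -fsbig_finite//= -fimfunE -lee_fin; exact: gh.
Qed.

End GeneratedMeasure.

(** * The metric space associated with a pseudometric *)

Section MetricQuotient.
Local Open Scope quotient_scope.
Context {R : realType} {T : choiceType} (D : T -> T -> R).
Context (Dxx : forall x, D x x = 0) (D_sym : forall x y, D x y = D y x).
Context (D_triangle : forall y x z, D x z <= D x y + D y z).

(** [M] identifies the points at distance zero: by the triangle inequality the
    distance is compatible with this equivalence, and it separates classes. *)
Lemma metric_quotient_exists :
  exists (M : metricType R) (class : T -> M),
    (forall m, exists x, class x = m) /\
    (forall x y, mdist (class x) (class y) = D x y).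
Proof.
have D_ge0 x y : 0 <= D x y.
  by rewrite -(@pmulrn_lge0 _ _ 2)// -(Dxx x) mulr2n {2}D_sym.
have D0_congr x x' y : D x x' = 0 -> D x y = D x' y.
  move=> xx'; apply/eqP; rewrite eq_le; apply/andP; split.
    by rewrite (le_trans (D_triangle x' _ _))// xx' add0r.
  by rewrite (le_trans (D_triangle x _ _))// D_sym xx' add0r.
pose e x y := D x y == 0.
have e_refl : reflexive e by move=> x; rewrite /e Dxx.
have e_sym : ssrbool.symmetric e by move=> x y; rewrite /e D_sym.
have e_trans : transitive e.
  by move=> y x z /eqP xy; rewrite /e (D0_congr _ _ _ xy).
pose eE := EquivRel e e_refl e_sym e_trans.
pose Q : choiceType := {eq_quot eE}.
pose class (x : T) : Q := \pi_({eq_quot eE}) x.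
pose dist (q r : Q) : R := D (repr q) (repr r).
have dist_class x y : dist (class x) (class y) = D x y.
  have r0 z : D (repr (class z)) z = 0.
    by apply/eqP; rewrite -[_ == 0]/(eE _ _) -eqmodE reprK.
  by rewrite /dist (D0_congr _ _ _ (r0 x)) D_sym (D0_congr _ _ _ (r0 y)) D_sym.
have dist_xx q : dist q q = 0 by exact: Dxx.
have dist_pos q r : dist q r = 0 -> q = r.
  move=> /eqP qr; rewrite -[q]reprK -[r]reprK.
  by apply/eqP; rewrite eqmodE.
have dist_sym q r : dist q r = dist r q by exact: D_sym.
have dist_tri r q s : dist q s <= dist q r + dist r s by exact: D_triangle.
pose M : metricType R :=
  HB.pack (Choice.sort Q)
    (isMetric.Build R Q dist_xx dist_pos dist_sym dist_tri).
exists M, class; split => [m|x y]; last exact: dist_class.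
by exists (repr m); rewrite /class reprK.
Qed.

End MetricQuotient.

(** * Completeness of the space of p-integrable functions *)

Section RieszFischer.
Context {d : measure_display} {X : measurableType d} {R : realType}.
Context (nu : {measure set X -> \bar R}) (p : R) (p1 : 1 <= p).
Implicit Types (f g : X -> R) (v : nat -> X -> R) (c : R).

Local Notation N f := ('N[nu]_p%:E[EFin \o f%R])%E.

Let p_gt0 : 0 < p. Proof. exact: lt_le_trans p1. Qed.

Lemma measurable_norm_powR f : measurable_fun setT f ->
  measurable_fun setT (fun x => (`|f x| `^ p)%:E).
Proof.
move=> mf; apply/measurable_EFinP.
by apply: (measurableT_comp (measurable_powR p)); exact: measurableT_comp.
Qed.

Lemma LnormE f : N f = ((\int[nu]_x (`|f x| `^ p)%:E) `^ p^-1)%E.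
Proof. by rewrite unlock. Qed.

Lemma Lnorm_leP f c : 0 <= c ->
  (N f <= c%:E)%E <-> (\int[nu]_x (`|f x| `^ p)%:E <= (c `^ p)%:E)%E.
Proof.
move=> c0; have i0 : (0 <= \int[nu]_x (`|f x| `^ p)%:E)%E.
  by apply: integral_ge0 => x _; rewrite lee_fin powR_ge0.
have -> : (\int[nu]_x (`|f x| `^ p)%:E = N f `^ p)%E.
  by rewrite LnormE -poweRrM mulVf ?gt_eqF// poweRe1.
rewrite -poweR_EFin; split=> [Nc|Nc].
  apply: gt0_ler_poweR; rewrite ?in_itv/= ?leey ?andbT ?Lnorm_ge0//.
  exact: ltW.
have rootK (y : \bar R) : (0 <= y)%E -> ((y `^ p) `^ p^-1 = y)%E.
  by move=> y0; rewrite -poweRrM divff ?gt_eqF// poweRe1.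
rewrite -[leLHS]rootK ?Lnorm_ge0// -[leRHS]rootK//.
apply: gt0_ler_poweR; rewrite ?in_itv/= ?leey ?andbT ?poweR_ge0//.
  by rewrite invr_ge0 ltW.
by rewrite lee_fin powR_ge0.
Qed.

(** The power function is differentiable, hence continuous, at positive points;
    at zero, [`|s n| < e `^ p^-1] gives [`|s n| `^ p < e]. *)
Lemma cvg_norm_powR (s : R^nat) (l : R) :
  s n @[n --> \oo] --> l -> (`|s n| `^ p) @[n --> \oo] --> `|l| `^ p.
Proof.
have [->|l0] := eqVneq l 0; last first.
  move=> /cvg_norm sl; apply: (cvg_comp _ (@powR R ^~ p) sl).
  have /derivable1_diffP/differentiable_continuous :
      derivable (@powR R ^~ p) `|l| 1.
    by apply: derivable_powR; rewrite in_itv/= normr_gt0 l0.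
  by [].
move=> s0; rewrite normr0 powR0 ?gt_eqF//; apply/cvgrPdist_lt => e e0.
have e1 : 0 < e `^ p^-1 by exact: powR_gt0.
move/cvgrPdist_lt : s0 => /(_ _ e1); apply: filterS => n.
rewrite !sub0r !normrN.
rewrite (ger0_norm (powR_ge0 _ _)) => sn.
rewrite (_ : e = (e `^ p^-1) `^ p); last first.
  by rewrite -powRrM mulVf ?gt_eqF// powRr1// ltW.
by apply: gt0_ltr_powR; rewrite // nnegrE ?normr_ge0 ?powR_ge0.
Qed.

(** Fatou's lemma for [`|v n x| `^ p], whose lower limit is almost everywhere
    [`|f x| `^ p] by the continuity of the power function. *)
Lemma Lnorm_fatou v f c : 0 <= c ->
  (forall n, measurable_fun setT (v n)) -> measurable_fun setT f ->
  {ae nu, forall x, v n x @[n --> \oo] --> f x} ->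
  (\forall n \near \oo, (N (v n) <= c%:E)%E) -> (N f <= c%:E)%E.
Proof.
move=> c0 mv mf vf [n0 _ vc]; apply/Lnorm_leP => //.
pose w n x := (`|v n x| `^ p)%:E.
have mw n : measurable_fun setT (w n) by exact: measurable_norm_powR.
have w0 n x : (0 <= w n x)%E by rewrite lee_fin powR_ge0.
have -> : (\int[nu]_x (`|f x| `^ p)%:E = \int[nu]_x limn_einf (w ^~ x))%E.
  apply: ge0_ae_eq_integral => //.
  - exact: measurable_norm_powR.
  - rewrite (_ : (fun x => limn_einf _) =
        fun x => - limn_esup (fun n => - w n x))%E.
      apply: measurableT_comp => //; apply: measurable_fun_limn_esup => n.
      exact: measurableT_comp.
    apply/funext => x; rewrite -limn_einfN; congr limn_einf.
    by apply/funext => n /=; rewrite opprK.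
  - move=> x _; rewrite limn_einf_lim.
    apply: lime_ge; first exact: is_cvg_einfs.
    by apply: nearW => n; apply: le_ereal_inf_tmp => _ [k _ <-].
  apply: filterS vf => x vfx _.
  suff /cvg_limn_einf_sup[-> _] : w n x @[n --> \oo] --> (`|f x| `^ p)%:E by [].
  apply: cvg_EFin; first exact: nearW.
  exact: cvg_norm_powR.
apply: le_trans (fatou nu measurableT mw _) _ => //.
rewrite limn_einf_lim; apply: lime_le; first exact: is_cvg_einfs.
apply: nearW => n; apply: (@le_trans _ _ (\int[nu]_x w (maxn n n0) x)%E).
  by apply: ereal_inf_lbound; exists (maxn n n0) => //=; exact: leq_maxl.
by apply/Lnorm_leP => //; apply: vc; exact: leq_maxr.
Qed.

(** The partial sums of the absolute increments have norm at most
    [1 + 1/2 + 1/4 + ... = 2]; by monotone convergence their limit has a finite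
    integral, hence is finite almost everywhere. *)
Lemma ae_cvg_of_geometric_increments v :
  (forall n, measurable_fun setT (v n)) ->
  (forall n, (N (v n.+1 \- v n)%R <= (2^-1 ^+ n)%:E)%E) ->
  {ae nu, forall x, cvgn (v ^~ x)}.
Proof.
move=> mv dv.
pose G n x := \sum_(0 <= k < n) `|v k.+1 x - v k x|.
have md n : measurable_fun setT (fun x => `|v n.+1 x - v n x|).
  by apply: measurableT_comp => //; exact: measurable_funB.
have mG n : measurable_fun setT (G n).
  by apply: measurable_sum => k; exact: md.
have G0 n x : 0 <= G n x by exact: sumr_ge0.
have GS n : G n.+1 = (G n \+ (fun x => `|v n.+1 x - v n x|)).
  by apply/funext => x; rewrite /G big_nat_recr.
have NG n : (N (G n) <= (2 - 2 * 2^-1 ^+ n)%:E)%E.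
  elim: n => [|n IH].
    rewrite (_ : G 0%N = cst 0); last by apply/funext => x; rewrite /G big_geq.
    by rewrite Lnorm0 ?eqe ?gt_eqF// expr0 mulr1 subrr.
  rewrite GS; apply: le_trans (minkowski_EFin _ (mG n) (md n) p1) _.
  have -> : 2 - 2 * 2^-1 ^+ n.+1 = (2 - 2 * 2^-1 ^+ n) + 2^-1 ^+ n :> R.
    by rewrite exprS; field.
  rewrite EFinD; apply: leeD => //; apply: le_trans (dv n).
  by rewrite !LnormE; under eq_integral do rewrite normr_id.
pose g n x := (`|G n x| `^ p)%:E.
have mg n : measurable_fun setT (g n) by exact: measurable_norm_powR.
have g0 n x : (0 <= g n x)%E by rewrite lee_fin powR_ge0.
have G_nd x : {homo G ^~ x : m n / (m <= n)%N >-> m <= n}.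
  move=> m n mn; rewrite /G (big_cat_nat (leq0n m) mn)/= lerDl.
  by apply: sumr_ge0.
have g_nd x : {homo g ^~ x : m n / (m <= n)%N >-> (m <= n)%E}.
  move=> m n mn; rewrite lee_fin !ger0_norm//.
  by apply: ge0_ler_powR; rewrite ?nnegrE//; [exact: ltW|exact: G_nd].
have g_cvg x : cvgn (g ^~ x) by exact: ereal_nondecreasing_is_cvgn.
have int_lim : nu.-integrable setT (fun x => limn (g ^~ x)).
  apply/integrableP; split.
    by apply: emeasurable_fun_cvg mg _ => x _; exact: g_cvg.
  have -> : (\int[nu]_x `|limn (g ^~ x)| = \int[nu]_x limn (g ^~ x))%E.
    apply: eq_integral => x _; rewrite gee0_abs//.
    by apply: lime_ge => //; exact: nearW.
  rewrite monotone_convergence//.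
  apply: (@le_lt_trans _ _ (2 `^ p)%:E); last by rewrite ltry.
  apply: lime_le.
    apply: ereal_nondecreasing_is_cvgn => m n mn.
    by apply: ge0_le_integral => // x _; exact: g_nd.
  apply: nearW => n; apply/Lnorm_leP => //; apply: le_trans (NG n) _.
  by rewrite lee_fin gerBl mulr_ge0// exprn_ge0// invr_ge0.
apply: filterS (integrable_ae measurableT int_lim) => x /(_ Logic.I) lim_fin.
have G_cvg : cvgn (G ^~ x).
  apply: nondecreasing_is_cvgn; first exact: G_nd.
  exists (fine (limn (g ^~ x)) `^ p^-1) => _ [n _ <-].
  have -> : G n x = (`|G n x| `^ p) `^ p^-1.
    by rewrite -powRrM divff ?gt_eqF// powRr1// ger0_norm.
  apply: ge0_ler_powR; rewrite ?nnegrE ?powR_ge0 ?invr_ge0 ?(ltW p_gt0)//.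
    by apply: fine_ge0; apply: lime_ge => //; exact: nearW.
  rewrite -lee_fin fineK//; apply: lime_ge => //.
  by exists n => // m /= nm; exact: g_nd.
have : cvgn (series (telescope (v ^~ x))).
  by apply: (@normed_cvg _ R^o); exact: G_cvg.
rewrite telescopeK => tel_cvg.
rewrite (_ : v ^~ x = [sequence v n x - v 0%N x]_n \+ cst (v 0%N x)).
  by apply: is_cvgD => //; exact: is_cvg_cst.
by apply/funext => n /=; rewrite subrK.
Qed.

Lemma Lnorm_mul_indic_le f A : measurable A -> measurable_fun setT f ->
  (N (f \* \1_A) <= N f)%E.
Proof.
move=> mA mf.
have mfA : measurable_fun setT (f \* \1_A) by exact: measurable_funM.
rewrite !LnormE; apply: gt0_ler_poweR; first by rewrite invr_ge0 ltW.
1,2: rewrite in_itv/= leey andbT; apply: integral_ge0 => x _.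
1,2: by rewrite lee_fin powR_ge0.
apply: ge0_le_integral => //; try exact: measurable_norm_powR.
move=> x _; rewrite lee_fin.
apply: ge0_ler_powR; rewrite ?nnegrE//; first exact: ltW.
by rewrite /= indicE; case: (_ \in _); rewrite ?mulr1// mulr0 normr0.
Qed.

Lemma Lnorm_distC f g : N (f \- g) = N (g \- f).
Proof. by rewrite !LnormE; under eq_integral do rewrite distrC. Qed.

Lemma Lnorm_triangle f g h : measurable_fun setT f -> measurable_fun setT g ->
  measurable_fun setT h -> (N (f \- h) <= N (f \- g) + N (g \- h))%E.
Proof.
move=> mf mg mh; rewrite (_ : f \- h = (f \- g) \+ (g \- h)); last first.
  by apply/funext => x /=; rewrite addrA subrK.
by apply: minkowski_EFin => //; exact: measurable_funB.
Qed.

Lemma Lnorm_lty_sub f g : measurable_fun setT f -> measurable_fun setT g ->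
  (N f < +oo)%E -> (N g < +oo)%E -> (N (f \- g) < +oo)%E.
Proof.
move=> mf mg Nf Ng.
have := Lnorm_triangle mf (measurable_cst (0 : R)) mg.
have sub0 (h : X -> R) : h \- cst 0 = h by apply/funext => x /=; rewrite subr0.
rewrite (Lnorm_distC (cst 0) g) !sub0 => /le_lt_trans; apply.
exact: lte_add_pinfty.
Qed.

Lemma geometric_subsequence v :
  (forall e, 0 < e -> exists m, forall i j, (m <= i)%N -> (m <= j)%N ->
    (N (v i \- v j) <= e%:E)%E) ->
  exists phi : nat -> nat, (forall k, k <= phi k)%N /\
    forall k, (N (v (phi k.+1) \- v (phi k))%R <= (2^-1 ^+ k)%:E)%E.
Proof.
move=> v_cauchy.
have /choice[M Mv] k : exists m, forall i j, (m <= i)%N -> (m <= j)%N ->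
    (N (v i \- v j) <= (2^-1 ^+ k)%:E)%E.
  by apply: v_cauchy; rewrite exprn_gt0// invr_gt0.
(* The maximum with [k] makes [phi] tend to infinity, and the maximum over the
   indices up to [k] makes both [phi k] and [phi k.+1] exceed [M k]. *)
pose phi k := maxn k (\max_(j < k.+1) M j).
have M_phi (j : nat) k : (j < k.+1)%N -> (M j <= phi k)%N.
  move=> jk; apply: leq_trans (leq_maxr _ _).
  exact: (leq_bigmax (F := fun i : 'I_k.+1 => M i) (Ordinal jk)).
exists phi; split => k; first exact: leq_maxl.
by apply: Mv; apply: M_phi => //; exact: ltnW.
Qed.

(** A subsequence with geometric increments converges almost everywhere, and
    Fatou's lemma applied to [u n - u (phi k)] as [k] grows bounds the distance
    from [u n] to its limit. *)
Lemma Lnorm_complete (u : nat -> X -> R) :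
  (forall n, measurable_fun setT (u n)) -> (forall n, N (u n) < +oo)%E ->
  (forall e, 0 < e -> exists m, forall i j, (m <= i)%N -> (m <= j)%N ->
    (N (u i \- u j) <= e%:E)%E) ->
  exists l : X -> R, [/\ measurable_fun setT l, (N l < +oo)%E &
    forall e, 0 < e -> exists m, forall n, (m <= n)%N ->
      (N (u n \- l) <= e%:E)%E].
Proof.
move=> m_u u_fin u_cauchy.
have [phi [phi_ge phi_geo]] := geometric_subsequence u_cauchy.
have mv k : measurable_fun setT (u (phi k)) by exact: m_u.
have v_cvg := ae_cvg_of_geometric_increments mv phi_geo.
(* The upper limit serves as a value measurable on the whole space; it is the
   limit wherever the latter exists. *)
pose l x := fine (limn_esup (fun k => (u (phi k) x)%:E)).
have ml : measurable_fun setT l.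
  apply: measurableT_comp; first exact: fine_measurable.
  by apply: measurable_fun_limn_esup => k; exact/measurable_EFinP.
have v_l : {ae nu, forall x, u (phi k) x @[k --> \oo] --> l x}.
  apply: filterS v_cvg => x vx; rewrite /l.
  have /cvg_limn_einf_sup[_ ->] :
      (u (phi k) x)%:E @[k --> \oo] --> (limn (fun k => u (phi k) x))%:E.
    by apply: cvg_EFin; [exact: nearW|exact: vx].
  exact: vx.
have u_l e : 0 < e ->
    exists m, forall n, (m <= n)%N -> (N (u n \- l) <= e%:E)%E.
  move=> e0; have [m um] := u_cauchy _ e0; exists m => n mn.
  apply: (@Lnorm_fatou (fun k => u n \- u (phi k))); first exact: ltW.
  - by move=> k; exact: measurable_funB.
  - exact: measurable_funB.
  - apply: filterS v_l => x vx; apply: cvgB; [exact: cvg_cst|exact: vx].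
  - by exists m => // k /= mk; apply: um => //; exact: leq_trans (phi_ge k).
exists l; split => //.
have [m um] := u_l 1 ltr01; have um1 := um _ (leqnn m).
have -> : l = u m \- (u m \- l) by apply/funext => x /=; rewrite subKr.
apply: Lnorm_lty_sub => //; first exact: measurable_funB.
exact: le_lt_trans um1 (ltry _).
Qed.

End RieszFischer.

(** * The pan-norm as an Lp-norm, and the theorem *)

Section PanNorm.
Context {d : measure_display} {X : measurableType d} {R : realType}.
Context (mu : set X -> \bar R) (nu : {measure set X -> \bar R}).
Context (mu_mono : monotone_measure mu).
Context (nuE : forall A, nu A = pan_integral mu \1_A).
Context (E : set X) (mE : measurable E) (p : R) (p1 : 1 <= p).
Implicit Types f g : X -> R.

Let p_gt0 : 0 < p. Proof. exact: lt_le_trans p1. Qed.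

Lemma measurable_fun_mul_indic f :
  measurable_fun E f -> measurable_fun setT (f \* \1_E).
Proof. by rewrite (measurable_restrictT _ mE) patch_indic. Qed.

Lemma pan_normE f : measurable_fun E f ->
  pan_norm mu E p f = ('N[nu]_p%:E[EFin \o (f \* \1_E)%R])%E.
Proof.
move=> mf; rewrite LnormE /pan_norm; congr (_ `^ _)%E.
rewrite /pan_integral_on (_ : (fun x => _) = fun x => `|f x * \1_E x| `^ p).
  apply: pan_integralE => //.
  by apply/measurable_EFinP/measurable_norm_powR/measurable_fun_mul_indic.
apply/funext => x; rewrite indicE; case: (_ \in _); rewrite ?mulr1//.
by rewrite !mulr0 normr0 powR0// gt_eqF.
Qed.

Lemma ae_equal_onP f g : measurable_fun E f -> measurable_fun E g ->
  ae_equal_on mu E f g <->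
  ('N[nu]_p%:E[EFin \o (f \* \1_E \- g \* \1_E)%R] = 0)%E.
Proof.
move=> mf mg.
have mfg : measurable_fun setT (f \* \1_E \- g \* \1_E).
  by apply: measurable_funB; exact: measurable_fun_mul_indic.
pose S := E `&` [set x | f x <> g x].
have SE : S = ~` ((f \* \1_E \- g \* \1_E) @^-1` [set 0]).
  apply/seteqP; split => x /=.
    move=> [xE fg]; rewrite indicE mem_set// !mulr1 => /eqP.
    by rewrite subr_eq0 => /eqP.
  rewrite indicE; case: (boolP (x \in E)) => [/set_mem xE|_]; last first.
    by rewrite !mulr0 subrr.
  by rewrite !mulr1 => fg; split => // fgx; apply: fg; rewrite fgx subrr.
have mS : measurable S.
  rewrite SE; apply: measurableC.
  by rewrite -[X in measurable X]setTI; exact: mfg.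
rewrite /ae_equal_on -/S -(pan_indic_eq0 mu_mono mS) -nuE.
split=> [S0|N0].
  rewrite LnormE (_ : (\int[nu]_x _)%E = 0%E) ?poweR0r ?invr_neq0 ?gt_eqF//.
  apply/eqP; rewrite -(@integral0 _ X R nu setT); apply/eqP.
  apply: ge0_ae_eq_integral => //; first exact: measurable_norm_powR.
  exists S; split => // x /= /not_implyP[_ ne]; rewrite SE => /= fg0.
  by apply: ne; rewrite fg0 normr0 powR0// gt_eqF.
have mfgE : measurable_fun setT (EFin \o (f \* \1_E \- g \* \1_E)).
  exact/measurable_EFinP.
have [Z [mZ Z0 SZ]] := Lnorm_eq0_eq0 mfgE (p_gt0 : (0 < p%:E)%E) N0.
apply/eqP; rewrite eq_le measure_ge0 andbT -Z0.
apply: le_measure; rewrite ?inE//; rewrite SE => x /= fg; apply: SZ => /= h.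
by apply: fg; have [] := h Logic.I.
Qed.

End PanNorm.

Theorem theorem6p2 (R : realType) (d : measure_display) (X : measurableType d)
    (mu : set X -> \bar R) (E : set X) (p : R) :
  monotone_measure mu -> measurable E -> 1 <= p ->
  subadditive_measure mu -> continuous_from_below mu ->
  exists (M : metricType R) (class : pan_Lp mu E p -> M),
    [/\ forall m : M, exists f, class f = m,
        forall f g, class f = class g <-> ae_equal_on mu E (\val f) (\val g),
        forall f g, (mdist (class f) (class g))%:E =
          pan_norm mu E p (\val f \- \val g) &
        complete_metric M].
Proof.
move=> mu_mono mE p1 mu_sub mu_cfb.
have [nu nuE] := generated_measure_exists mu_mono mu_sub mu_cfb.
have normE := pan_normE mu_mono nuE mE p1.
pose N (f : X -> R) := ('N[nu]_p%:E[EFin \o f])%E.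
pose r (f : pan_Lp mu E p) := \val f \* \1_E.
have mval (f : pan_Lp mu E p) : measurable_fun E (\val f).
  by have /set_mem[] := valP f.
have mr f : measurable_fun setT (r f) by exact: measurable_fun_mul_indic.
have Nr f : (N (r f) < +oo)%E.
  by rewrite /N -normE//; have /set_mem[] := valP f.
pose D f g := fine (N (r f \- r g)).
have DE f g : (D f g)%:E = N (r f \- r g).
  rewrite /D fineK// ge0_fin_numE; last exact: Lnorm_ge0.
  exact: (Lnorm_lty_sub p1 (mr f) (mr g) (Nr f) (Nr g)).
have D_normE f g : (D f g)%:E = pan_norm mu E p (\val f \- \val g).
  rewrite normE; last exact: measurable_funB.
  rewrite DE; congr Lnorm; apply/funext => x /=; congr EFin.
  by rewrite /r mulrBl.
have D_eq0 f g : D f g = 0 <-> ae_equal_on mu E (\val f) (\val g).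
  rewrite (ae_equal_onP mu_mono nuE mE p1)// -/(N _) -DE.
  by split=> [->//|[]].
have Dxx f : D f f = 0.
  apply/D_eq0; rewrite /ae_equal_on (_ : _ `&` _ = set0) ?monotone_measure0//.
  by apply/seteqP; split => // x [].
have D_sym f g : D f g = D g f by rewrite /D /N Lnorm_distC.
have D_tri g f h : D f h <= D f g + D g h.
  by rewrite -lee_fin EFinD !DE; exact: Lnorm_triangle.
have [M [class [class_surj class_dist]]] :=
  metric_quotient_exists Dxx D_sym D_tri.
exists M, class; split => // [f g|f g|u u_cauchy].
- rewrite -D_eq0 -class_dist; split => [->|]; first exact: mdistxx.
  exact: mdist_positivity.
- by rewrite class_dist.
have [f fE] := choice (fun n => class_surj (u n)).
have [l [ml Nl f_l]] : exists l : X -> R,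
    [/\ measurable_fun setT l, (N l < +oo)%E &
    forall e, 0 < e -> exists m, forall n, (m <= n)%N ->
      (N (r (f n) \- l)%R <= e%:E)%E].
  apply: (Lnorm_complete p1 (fun n => mr (f n)) (fun n => Nr (f n))) => e e0.
  move/cauchy_ballP : u_cauchy => /(_ _ e0)[[A B] [/= [a _ aA] [b _ bB]] AB].
  exists (maxn a b) => i j; rewrite !geq_max => /andP[ai _] /andP[_ bj].
  have := AB (u i, u j) (conj (aA _ ai) (bB _ bj)).
  rewrite /= ballEmdist /= -!fE class_dist -lte_fin DE; exact: ltW.
have mlE : measurable_fun E l by exact: measurable_funTS.
(* The functions [r (f n)] vanish outside [E], so restricting [l] to [E]
   can only decrease its distance to them. *)
have l_Lp : l \in pan_Lp mu E p.
  apply/mem_set; split => //; rewrite normE//.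
  exact: le_lt_trans (Lnorm_mul_indic_le nu p1 mE ml) Nl.
exists (class (exist _ l l_Lp)).
apply/metricType_numDomainType.cvgrPdist_lt => e e0.
have [|m f_lm] := f_l (e / 2); first by rewrite divr_gt0.
exists m => // n /= mn; rewrite -fE metric_sym class_dist -lte_fin DE.
rewrite (_ : r (f n) \- _ = (r (f n) \- l) \* \1_E); last first.
  apply/funext => x; rewrite /r /= mulrBl; congr (_ - _).
  by rewrite -mulrA indicE; case: (_ \in _); rewrite ?mulr0 ?mulr1.
have mfl : measurable_fun setT (r (f n) \- l) by exact: measurable_funB.
apply: le_lt_trans (Lnorm_mul_indic_le nu p1 mE mfl) _.
apply: le_lt_trans (f_lm _ mn) _.
by rewrite lte_fin ltr_pdivrMr// ltr_pMr// ltr1n.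
Qed.
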